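(* Let $\mathcal{X}\subset\mathbb{R}^d$ be a compact metric space, $\mathcal{Y}\subset\mathbb{R}$, and let $(X,Y)$ be distributed according to a probability measure $\rho$ on $\mathcal{X}\times\mathcal{Y}$ with marginal $\rho_{\mathcal{X}}$ on $\mathcal{X}$. Let $f^\star(x)=\mathbb{E}(Y\mid X=x)$ be bounded, let $\mathcal{H}\subset C(\mathcal{X})$ be uniformly bounded, and set $M=\max\{\|f^\star\|_\infty,\sup_{f\in\mathcal{H}}\|f\|_\infty\}$. Assume there is $\epsilon>0$ with $\mathbb{E}|Y|^{1+\epsilon}<+\infty$. Let $\sigma>\max\{2M,1\}$. Then there exists a constant $c_\epsilon>0$ independent of $\sigma$ such that for every measurable function $f:\mathcal{X}\to\mathbb{R}$ with $\|f\|_\infty\le M$, \[ \Big|\big[\mathcal{R}^\sigma(f)-\mathcal{R}^\sigma(f^\star)\big]-\|f-f^\star\|_{2,\rho}^2\Big|\le \frac{c_\epsilon}{\sigma^\epsilon}. \]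
   Context: The Huber loss with scale parameter $\sigma>0$ is $\ell_\sigma(t)=t^2$ if $|t|\le\sigma$ and $\ell_\sigma(t)=2\sigma|t|-\sigma^2$ otherwise. The generalization error of a measurable $f:\mathcal{X}\to\mathbb{R}$ is $\mathcal{R}^\sigma(f)=\mathbb{E}\,\ell_\sigma(Y-f(X))$, the expectation taken jointly over $(X,Y)\sim\rho$. $\|g\|_{2,\rho}$ denotes the $L^2(\rho_{\mathcal{X}})$ norm $\big(\int_{\mathcal{X}} g(x)^2\,d\rho_{\mathcal{X}}(x)\big)^{1/2}$. *)

(* Defs.v *)
From mathcomp Require Import all_boot all_order all_algebra.
From mathcomp Require Import all_classical all_reals all_analysis.
Set Implicit Arguments. Unset Strict Implicit. Unset Printing Implicit Defensive.
Import Order.TTheory GRing.Theory Num.Theory.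
Import numFieldNormedType.Exports.
Local Open Scope classical_set_scope.
Local Open Scope ring_scope.

(* R^d with its Borel sigma-algebra (generated by the open sets of the
   normed space 'rV[R]_d).  Definitionally equal to 'rV[R]_d. *)
Definition Rd (R : realType) (d : nat) : Type :=
  g_sigma_algebraType (@open 'rV[R]_d).

Definition huber (R : realType) (s t : R) : R :=
  if `|t| <= s then t ^+ 2 else 2 * s * `|t| - s ^+ 2.

Definition huber_risk (R : realType) (d : nat)
    (rho : probability (Rd R d * R)%type R) (sigma : R) (f : 'rV[R]_d -> R)
    : \bar R :=
  (\int[rho]_z (huber sigma (z.2 - f z.1))%:E)%E.

Definition marginalX (R : realType) (d : nat)
    (rho : probability (Rd R d * R)%type R) : set (Rd R d) -> \bar R :=
  pushforward rho fst.

Definition L2sq (R : realType) (d : nat)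
    (rho : probability (Rd R d * R)%type R) (g : 'rV[R]_d -> R) : \bar R :=
  (\int[marginalX rho]_x ((g x) ^+ 2)%:E)%E.

Definition supnorm (R : realType) (d : nat) (X : set 'rV[R]_d)
    (g : 'rV[R]_d -> R) : R :=
  sup [set `|g x| | x in X].

Definition cond_exp_version (R : realType) (d : nat)
    (rho : probability (Rd R d * R)%type R) (X : set 'rV[R]_d)
    (g : 'rV[R]_d -> R) : Prop :=
  [/\ measurable_fun (X : set (Rd R d)) (g : Rd R d -> R),
      rho.-integrable setT (fun z => (z.2)%:E) &
      forall B : set (Rd R d), measurable B -> B `<=` X ->
        (\int[rho]_(z in B `*` setT) (z.2)%:E =
         \int[rho]_(z in B `*` setT) (g z.1)%:E)%E].

(* Main.v *)
(* Since f* is the conditional mean and f - f* is bounded and depends on x only,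
   E[(Y - f*(X)) (f*(X) - f(X))] = 0, so ||f - f*||^2 is "formally" the excess
   risk of the square loss, although E[Y^2] may be infinite. The Huber and
   square losses of Y - f(X) and Y - f*(X) coincide when |Y| <= sigma/2, because
   M < sigma/2. When |Y| > sigma/2, both excess losses are O(M |Y|), the Huber
   loss being 2 sigma-Lipschitz, and |Y| <= |Y|^(1+eps) (2/sigma)^eps; hence
   c_eps = 16 M 2^eps E|Y|^(1+eps), up to an additive 1 for positivity. *)
Require Import Defs.
From mathcomp Require Import all_boot all_order all_algebra ring lra.
From mathcomp Require Import all_classical all_reals all_analysis.
From mathcomp Require Import measurable_realfun.
Import Order.TTheory GRing.Theory Num.Theory.
Import numFieldNormedType.Exports.
Import HBNNSimple.
Local Open Scope classical_set_scope.
Local Open Scope ring_scope.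

(** * Pointwise estimates for the Huber loss *)

Lemma huber_lipschitz (R : realType) (s t u : R) : 0 <= s ->
  `|huber s t - huber s u| <= 2 * s * `|t - u|.
Proof.
move=> s0.
(* The loss is even and [| |t| - |u| | <= |t - u|], so ordered nonnegative arguments suffice. *)
suff H (a b : R) : 0 <= a -> 0 <= b -> a <= b ->
    `|huber s a - huber s b| <= 2 * s * (b - a).
  have E x : huber s x = huber s `|x|.
    by rewrite /huber normr_id real_normK ?num_real.
  rewrite (E t) (E u); apply: (@le_trans _ _ (2 * s * `| `|t| - `|u| |)).
    have [tu|ut] := leP `|t| `|u|.
      by rewrite [X in _ <= _ * X]distrC [X in _ <= _ * X]ger0_norm ?subr_ge0// H.
    by rewrite distrC [X in _ <= _ * X]ger0_norm ?subr_ge0 ?H// ltW.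
  by apply: ler_wpM2l; [lra|exact: ler_dist_dist].
move=> a0 b0 ab; rewrite /huber (ger0_norm a0) (ger0_norm b0).
case: (leP a s) => as_; case: (leP b s) => bs; rewrite ler_norml; apply/andP; split; nra.
Qed.

(** The subtracted expression is the square-loss excess, split so that the cross term
    [(b - a) * (y - b)] integrates to zero once [b] is the conditional mean. The right side is
    integrable under the moment assumption alone. *)
Lemma huber_approx (R : realType) (s M e y a b : R) :
  0 <= M -> 0 < s -> 2 * M < s -> `|a| <= M -> `|b| <= M -> 0 < e ->
  `|huber s (y - a) - huber s (y - b) - (2 * ((b - a) * (y - b)) + (a - b) ^+ 2)|
    <= 16 * M * 2 `^ e / s `^ e * `|y| `^ (1 + e).
Proof.
move=> M0 s0 sM aM bM e0.
have -> : 2 * ((b - a) * (y - b)) + (a - b) ^+ 2 = (y - a) ^+ 2 - (y - b) ^+ 2 by ring.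
have [ys|ys] := leP `|y| (s / 2).
  (* Here [|y - c| <= s / 2 + M < s], which is the quadratic branch. *)
  have H c : `|c| <= M -> huber s (y - c) = (y - c) ^+ 2.
    by move=> cM; rewrite /huber ifT//; apply: (le_trans (ler_normB _ _)); lra.
  by rewrite !H// subrr normr0 !mulr_ge0// ?powR_ge0// invr_ge0 powR_ge0.
have y0 : 0 < `|y| by lra.
apply: (@le_trans _ _ (16 * M * `|y|)).
  have ab : `|a - b| <= 2 * M by apply: (le_trans (ler_normB _ _)); lra.
  apply: (le_trans (ler_normB _ _)).
  have h1 := huber_lipschitz _ _ (y - a) (y - b) (ltW s0).
  have h2 : `|(y - a) ^+ 2 - (y - b) ^+ 2| <= `|a - b| * (2 * `|y| + 2 * M).
    rewrite (_ : (y - a) ^+ 2 - _ = (a - b) * (a + b - 2 * y)); last by ring.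
    rewrite normrM ler_wpM2l//; apply: (le_trans (ler_normB _ _)).
    by rewrite normrM [`|2|]ger0_norm//; have := ler_normD a b; lra.
  have E : (y - a) - (y - b) = - (a - b) by ring.
  rewrite E normrN in h1.
  have := normr_ge0 (a - b); set w := `|a - b| in ab h1 h2 *.
  set v := `|y| in ys y0 h2 *; move=> w0.
  apply: (le_trans (lerD h1 h2)).
  (* The constant 16: [w <= 2 * M], while [s < 2 * v] and [2 * M < s] bound the other factor by
     [4 * v + 2 * v + 2 * v]. *)
  have : w * (2 * s + 2 * v + 2 * M) <= 2 * M * (8 * v) by apply: ler_pM; lra.
  lra.
(* As in Markov's inequality, [2 * |y| > s] makes the factor [(2 * |y| / s) ^ e] at least 1. *)
rewrite powRD; last by rewrite (gt_eqF y0) implybT.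
rewrite powRr1 ?normr_ge0//.
have -> : 16 * M * 2 `^ e / s `^ e * (`|y| * `|y| `^ e) =
  16 * M * `|y| * ((2 * `|y|) `^ e / s `^ e).
  by rewrite powRM//; ring.
rewrite -[leLHS]mulr1 ler_wpM2l ?mulr_ge0//.
rewrite ler_pdivlMr ?powR_gt0// mul1r; apply: ge0_ler_powR; rewrite ?nnegrE; lra.
Qed.

Lemma measurable_huber (R : realType) (s : R) : measurable_fun setT (huber s).
Proof.
apply: measurable_fun_ifT => //=.
- by apply: measurable_fun_ler => //; exact: measurableT_comp.
- apply: measurable_funB => //; apply: measurable_funM => //; exact: measurableT_comp.
Qed.

Lemma huber_ge0 (R : realType) (s t : R) : 0 <= s -> 0 <= huber s t.
Proof.
by move=> s0; rewrite /huber; case: (leP `|t| s) => ts; [rewrite sqr_ge0|nra].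
Qed.

(** * Measurability of the domain and removal of null sets *)

Lemma compact_measurable_Rd (R : realType) (d : nat) (X : set 'rV[R]_d) :
  compact X -> measurable (X : set (Rd R d)).
Proof.
move=> /compact_closed XC; rewrite -[X]setCK; apply: measurableC.
apply: sub_sigma_algebra; apply: closed_openC; apply: XC; exact: norm_hausdorff.
Qed.

(* No measurability of [f] off [D]: the integral of a nonnegative function is a
   supremum over simple functions below it. *)
Lemma ge0_integral_conull d (T : measurableType d) (R : realType)
    (mu : {measure set T -> \bar R}) (D : set T) (f : T -> \bar R) :
  measurable D -> mu (~` D) = 0%E -> measurable_fun D f ->
  (forall x, (0 <= f x)%E) ->
  (\int[mu]_x f x = \int[mu]_(x in D) f x)%E.
Proof.
move=> mD D0 mf f0; apply/eqP; rewrite eq_le; apply/andP; split; last first.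
  rewrite integral_mkcond !ge0_integralTE//; last by apply: erestrict_ge0.
  apply: ge_ereal_sup => _ [h /= hf <-]; apply: ereal_sup_ubound; exists h => //= x.
  by apply: (le_trans (hf x)); rewrite patchE; case: ifP.
rewrite ge0_integralTE//; apply: ge_ereal_sup => _ [h /= hf <-].
rewrite -integralT_nnsfun (ge0_negligible_integral _ _ _ _ D0)//; first last.
- by move=> x _; rewrite lee_fin.
- exact/measurable_EFinP.
- exact: measurableC.
rewrite setTD setCK; apply: ge0_le_integral => //.
- by move=> x _; rewrite lee_fin.
- exact/measurable_EFinP/measurable_funTS/measurable_funP.
Qed.

(** * Orthogonality to bounded functions of the conditioning variable *)

(** The sum counts the positive integers up to [t]; the bound [t <= N] ensures that none is
    missed. *)
Lemma sum_indic_approx (R : realType) (N : nat) (t : R) : 0 <= t -> t <= N%:R ->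
  `|t - \sum_(k < N) (k.+1%:R <= t)%R%:R| <= 1.
Proof.
move=> t0; elim: N => [|N IH] tN.
  by rewrite big_ord0 subr0 ger0_norm//; lra.
have [NT|tN'] := leP N%:R t; last first.
  have -> : \sum_(k < N.+1) (k.+1%:R <= t)%R%:R = \sum_(k < N) (k.+1%:R <= t)%R%:R :> R.
    by rewrite big_ord_recr /= [X in nat_of_bool X]lt_geF ?addr0// (lt_le_trans tN')// ler_nat.
  by apply: IH; exact: ltW.
rewrite big_ord_recr /= (eq_bigr (fun=> 1)); last first.
  by move=> k _; rewrite (le_trans _ NT)// ler_nat.
rewrite sumr_const card_ord; rewrite -natr1 in tN *.
rewrite ler_norml; case: (leP (N%:R + 1) t) => H; apply/andP; split; rewrite /=; lra.
Qed.

(** Extends orthogonality from indicators of events determined by [phi] to bounded functions of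
    [phi]: these are uniform limits of step functions, and [h] is integrable. It is applied to the
    residual of the conditional mean. *)
Lemma Rintegral_mul_comp_eq0 d1 d2 (T1 : measurableType d1) (T2 : measurableType d2)
    (R : realType) (mu : {measure set T1 -> \bar R}) (phi : T1 -> T2)
    (D : set T2) (h : T1 -> R) (u : T2 -> R) (K : R) :
  measurable_fun setT phi -> measurable D ->
  mu.-integrable (phi @^-1` D) (EFin \o h) ->
  (forall B, measurable B -> B `<=` D -> \int[mu]_(z in phi @^-1` B) h z = 0) ->
  measurable_fun D u -> (forall x, D x -> `|u x| <= K) ->
  \int[mu]_(z in phi @^-1` D) (h z * u (phi z)) = 0.
Proof.
move=> mphi mD ih h0 um uK.
set E := phi @^-1` D.
have mE : measurable E by rewrite -[E]setTI; apply: mphi.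
have muphi : measurable_fun E (u \o phi).
  apply: (measurable_comp mD) => //; first exact: image_preimage_subset.
  exact: measurable_funS mphi.
have ihm (g : T1 -> R) (C : R) : measurable_fun E g -> (forall z, E z -> `|g z| <= C) ->
    mu.-integrable E (EFin \o (fun z => h z * g z)).
  move=> mg gC; rewrite (_ : EFin \o _ = ((EFin \o h) \* (EFin \o g))%E); last first.
    by apply/funext => z /=; rewrite EFinM.
  apply: integrableMl => //; exists C; split; first exact: num_real.
  by move=> x Cx z Ez /=; apply: (le_trans (gC z Ez)); exact: ltW.
set I := LHS; apply/eqP; rewrite -normr_le0 leNgt; apply/negP => I0.
set J := \int[mu]_(z in E) `|h z|.
have J0 : 0 <= J by apply: Rintegral_ge0.
(* The mesh [1 / n] is chosen so fine that the final estimate [|I| <= J / n] contradicts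
   [I != 0]. *)
have [n nJ] : exists n : nat, J / `|I| < n%:R.
  by exists (Num.bound (J / `|I|)); apply: archi_boundP; rewrite divr_ge0.
have n0 : 0 < n%:R :> R by apply: le_lt_trans nJ; rewrite divr_ge0.
(* [N] levels of height [1 / n] cover the range of [u + |K|], which lies in [[0, 2 * |K|]] on [D].
   The absolute value matters because [K] may be negative when [D] is empty. *)
pose N := Num.bound (n%:R * (`|K| + `|K|)).
have NK : n%:R * (`|K| + `|K|) < N%:R.
  by apply: archi_boundP; rewrite mulr_ge0 ?addr_ge0.
pose B (k : nat) : set T2 := D `&` [set x | k%:R / n%:R <= u x + `|K| ].
have mB k : measurable (B k).
  have mv : measurable_fun D (fun x => u x + `|K|) by exact: measurable_funD.
  by have := mv mD _ (measurable_itv `[k%:R / n%:R, +oo[); rewrite preimage_itvcy.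
have mphiB k : measurable (phi @^-1` B k).
  by rewrite -[X in measurable X]setTI; exact: mphi.
pose w m z : R := \sum_(k < m) \1_(phi @^-1` B k.+1) z.
have mw m : measurable_fun E (w m).
  by apply: measurable_sum => k; exact: measurable_indic.
have wN m z : `|w m z| <= m%:R.
  apply: (le_trans (ler_norm_sum _ _ _)); rewrite -[in leRHS](card_ord m) -sumr_const.
  by apply: ler_sum => k _; rewrite indicE; case: (_ \in _); rewrite ?normr1 ?normr0.
(* Each layer contributes the integral of [h] over the preimage of one superlevel set, which
   vanishes by [h0]. *)
have Iw m : \int[mu]_(z in E) (h z * w m z) = 0.
  elim: m => [|m IH].
    under eq_Rintegral do rewrite /w big_ord0 mulr0.
    by rewrite Rintegral_cst// mul0r.
  under eq_Rintegral do rewrite /w big_ord_recr /= mulrDr.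
  rewrite RintegralD//; first last.
  - apply: (ihm _ 1); first exact: measurable_indic.
    by move=> z _; rewrite indicE; case: (_ \in _); rewrite ?normr1 ?normr0.
  - exact: (ihm _ m%:R (mw m) (fun z _ => wN m z)).
  rewrite [X in X + _](_ : _ = 0) ?add0r; last exact: IH.
  rewrite -(h0 (B m.+1)); [|exact: mB|by move=> x []].
  rewrite [in RHS](_ : phi @^-1` B m.+1 = E `&` phi @^-1` B m.+1); last first.
    by apply/seteqP; split => [z [] //|z []].
  rewrite Rintegral_mkcondr; apply: eq_Rintegral => z _.
  by rewrite patchE indicE; case: (_ \in _); rewrite ?mulr1 ?mulr0.
have Ic : \int[mu]_(z in E) (h z * `|K|) = 0.
  by rewrite RintegralZr// h0// mul0r.
(* [w N z] is the integer part of [n * (u (phi z) + |K|)], so [w N / n] is a step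
   function within [1/n] of [u \o phi + |K|]. *)
have approx z : E z -> `|u (phi z) + `|K| - n%:R^-1 * w N z| <= n%:R^-1.
  move=> Ez; have := uK _ Ez; have := ler_norm K; set k := `|K|.
  set t := u (phi z) => Kk tK.
  have /andP[t1 t2] : - k <= t <= k by rewrite -ler_norml (le_trans tK).
  have -> : t + k - n%:R^-1 * w N z = n%:R^-1 * (n%:R * (t + k) - w N z).
    by rewrite mulrBr mulKf// gt_eqF.
  rewrite normrM gtr0_norm ?invr_gt0// ler_piMr ?invr_ge0//.
  rewrite /w (eq_bigr (fun j : 'I_N => (j.+1%:R <= n%:R * (t + k))%R%:R)); last first.
    move=> j _; rewrite indicE; congr (_%:R); congr nat_of_bool.
    apply/idP/idP; rewrite inE /B /=.
      by move=> [_]; rewrite ler_pdivrMr// mulrC.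
    by move=> H; split => //; rewrite ler_pdivrMr// mulrC.
  apply: sum_indic_approx; first by rewrite mulr_ge0//; lra.
  by apply: le_trans (ltW NK); apply: ler_wpM2l; [exact: ltW|rewrite lerD2r].
have mg : measurable_fun E (fun z => u (phi z) + `|K| - n%:R^-1 * w N z).
  apply: measurable_funB; first exact: measurable_funD.
  by apply: measurable_funM => //; exact: mw.
(* The shift [|K|] and the step function are both orthogonal to [h], so inserting them leaves [I]
   unchanged. *)
have IE : I = \int[mu]_(z in E) (h z * (u (phi z) + `|K| - n%:R^-1 * w N z)).
  have iu := ihm _ _ muphi (fun z Ez => uK _ Ez).
  have iK : mu.-integrable E (EFin \o (fun z => h z * `|K|)).
    by apply: (ihm _ `|K|) => // *; rewrite normr_id.
  have iw := ihm _ _ (mw N) (fun z _ => wN N z).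
  transitivity (\int[mu]_(z in E) (h z * u (phi z) + h z * `|K| - n%:R^-1 * (h z * w N z))).
    rewrite RintegralB//; first last.
    - have := integrableZl mE n%:R^-1 iw.
      by apply: eq_integrable.
    - have := integrableD mE iu iK.
      by apply: eq_integrable.
    by rewrite RintegralD// RintegralZl// Ic Iw mulr0 subr0 addr0.
  by apply: eq_Rintegral => z _; ring.
have : `|I| <= n%:R^-1 * J.
  have ig := ihm _ _ mg approx.
  rewrite IE (le_trans (le_normr_Rintegral _ ig))// /J -RintegralZl//; last first.
    exact: integrable_norm.
  apply: le_Rintegral => //; first exact: (integrable_norm ig).
    by have := integrableZl mE n%:R^-1 (integrable_norm ih); apply: eq_integrable.
  by move=> z Ez; rewrite normrM mulrC ler_wpM2r// approx.
by rewrite ler_pdivlMl// leNgt -ltr_pdivrMr// nJ.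
Qed.

(** * Integrated comparison of excess risks *)

(** All integrals are moved to the full-measure cylinder over [X], where [f] and [g] are measurable
    and bounded, and merged into one; the bound [huber_approx] is then integrated. *)
Lemma huber_excess_risk_approx d (T : measurableType d) (R : realType)
    (rho : probability (T * R)%type R) (X : set T) (f g : T -> R) (M s e : R) :
  measurable X -> rho (~` (fst @^-1` X)) = 0%E ->
  0 <= M -> 0 < s -> 2 * M < s -> 0 < e ->
  rho.-integrable setT (fun z => (z.2)%:E) ->
  rho.-integrable setT (fun z => (`|z.2| `^ (1 + e))%:E) ->
  measurable_fun X f -> (forall x, X x -> `|f x| <= M) ->
  measurable_fun X g -> (forall x, X x -> `|g x| <= M) ->
  (forall B, measurable B -> B `<=` X ->
    \int[rho]_(z in fst @^-1` B) z.2 = \int[rho]_(z in fst @^-1` B) g z.1) ->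
  (`| ((\int[rho]_z (huber s (z.2 - f z.1))%:E) -
       (\int[rho]_z (huber s (z.2 - g z.1))%:E)) -
      \int[pushforward rho fst]_x ((f x - g x) ^+ 2)%:E | <=
   (16 * M * 2 `^ e / s `^ e * \int[rho]_z (`|z.2| `^ (1 + e))%R)%:E)%E.
Proof.
move=> mX X1 M0 s0 sM e0 iy ip mf fM mg gM gE.
set D : set (T * R) := fst @^-1` X.
have mpre B : measurable B -> measurable (fst @^-1` B : set (T * R)).
  by move=> mB; rewrite -[X in measurable X]setTI; exact: measurable_fst.
have mD : measurable D by exact: mpre.
have iyD : rho.-integrable D (EFin \o snd) by apply: integrableS iy.
have mcomp (c : T -> R) : measurable_fun X c -> measurable_fun D (fun z => c z.1).
  move=> mc; apply: (@measurable_comp _ _ _ _ _ _ X c D fst) => //.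
  - exact: image_preimage_subset.
  - exact: measurable_funTS.
have iB (c : T -> R) (K : R) : measurable_fun X c -> (forall x, X x -> `|c x| <= K) ->
    rho.-integrable D (EFin \o (fun z => c z.1)).
  move=> mc cK; apply: measurable_bounded_integrable => //.
  - by rewrite (le_lt_trans (probability_le1 _ _))// ltry.
  - exact: mcomp.
  - exists K; split; first exact: num_real.
    by move=> x Kx z Dz /=; apply: le_trans (ltW Kx); exact: cK.
have mH (c : T -> R) : measurable_fun X c -> measurable_fun D (fun z => huber s (z.2 - c z.1)).
  move=> mc; apply: (measurableT_comp (measurable_huber _ s)).
  by apply: measurable_funB; [exact: measurable_funTS|exact: mcomp].
have iH (c : T -> R) : measurable_fun X c -> (forall x, X x -> `|c x| <= M) ->
    rho.-integrable D (EFin \o (fun z => huber s (z.2 - c z.1))).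
  move=> mc cM.
  (* Since [huber s 0 = 0], the Lipschitz bound gives the dominating function [2 * s * (|y| + M)]; a
     finite first moment thus makes the Huber risks finite. *)
  have : rho.-integrable D (fun z => (2 * s)%:E * (`|z.2|%:E + M%:E))%E.
    apply: integrableZl => //; apply: integrableD => //.
    - exact: (integrable_norm iyD).
    - exact: finite_measure_integrable_cst.
  move=> ig; apply: (le_integrable mD _ _ ig).
    by apply/measurable_EFinP; exact: mH.
  move=> z Dz; rewrite -EFinD -EFinM /= lee_fin [leLHS]ger0_norm; last first.
    by apply: huber_ge0; exact: ltW.
  have := huber_lipschitz _ _ (z.2 - c z.1) 0 (ltW s0).
  rewrite [huber s 0](_ : _ = 0) ?subr0; last by rewrite /huber normr0 ltW// expr0n.
  move=> /(le_trans (ler_norm _)) /le_trans; apply.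
  rewrite [leRHS]ger0_norm; last by rewrite !mulr_ge0 ?addr_ge0// ltW.
  apply: ler_wpM2l; first by rewrite mulr_ge0// ltW.
  by apply: (le_trans (ler_normB _ _)); rewrite lerD2l cM.
have RE (c : T -> R) : measurable_fun X c -> (forall x, X x -> `|c x| <= M) ->
    (\int[rho]_z (huber s (z.2 - c z.1))%:E =
    (\int[rho]_(z in D) huber s (z.2 - c z.1))%R%:E)%E.
  move=> mc cM; rewrite (ge0_integral_conull _ _ _ _ D)//; first last.
  - by move=> z; rewrite lee_fin huber_ge0// ltW.
  - by apply/measurable_EFinP; exact: mH.
  by rewrite /Rintegral fineK//; apply: integrable_fin_num => //; exact: iH.
have mfg2 : measurable_fun X (fun x => (f x - g x) ^+ 2).
  by apply: measurable_funX; exact: measurable_funB.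
have fgM x : X x -> `|g x - f x| <= 2 * M.
  by move=> Xx; apply: (le_trans (ler_normB _ _)); have := fM x Xx; have := gM x Xx; lra.
have fg2M x : X x -> `|(f x - g x) ^+ 2| <= (2 * M) ^+ 2.
  by move=> Xx; rewrite normrX lerXn2r ?nnegrE ?mulr_ge0// distrC fgM.
have i2 := iB _ _ mfg2 fg2M.
have L2E : (\int[pushforward rho fst]_x ((f x - g x) ^+ 2)%:E =
    (\int[rho]_(z in D) ((f z.1 - g z.1) ^+ 2))%R%:E)%E.
  rewrite (ge0_integral_conull _ _ _ _ X)//; first last.
  - by move=> x; rewrite lee_fin sqr_ge0.
  - exact/measurable_EFinP.
  rewrite ge0_integral_pushforward//; first last.
  - by move=> x _; rewrite lee_fin sqr_ge0.
  - exact/measurable_EFinP.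
  by rewrite /Rintegral fineK//; exact: integrable_fin_num.
rewrite (RE f mf fM) (RE g mg gM) L2E -!EFinB /= lee_fin.
have ih : rho.-integrable D (EFin \o (fun z => z.2 - g z.1)).
  have := integrableB mD iyD (iB _ _ mg gM).
  by apply: eq_integrable.
have mgf : measurable_fun X (g \- f) by exact: measurable_funB.
have icross : rho.-integrable D (EFin \o (fun z => (g z.1 - f z.1) * (z.2 - g z.1))).
  pose p (z : T * R) := g z.1 - f z.1; pose q (z : T * R) := z.2 - g z.1.
  rewrite (_ : EFin \o _ = ((EFin \o p) \* (EFin \o q))%E); last first.
    by apply/funext => z /=; rewrite EFinM.
  apply: integrableMr => //; first exact: (mcomp (g \- f)).
  exists (2 * M); split; first exact: num_real.
  by move=> x Kx z Dz /=; apply: le_trans (ltW Kx); exact: fgM.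
(* The residual [z.2 - g z.1] has zero integral over every cylinder with base in [X], hence is
   orthogonal to the bounded function [g - f] of the first coordinate. *)
have cross0 : \int[rho]_(z in D) ((g z.1 - f z.1) * (z.2 - g z.1)) = 0.
  have := @Rintegral_mul_comp_eq0 _ _ _ _ _ rho fst X (fun z => z.2 - g z.1)
    (g \- f) (2 * M) measurable_fst mX ih _ mgf fgM.
  under eq_Rintegral do rewrite mulrC.
  apply=> B mB BX; rewrite RintegralB; [by rewrite gE// subrr|exact: mpre| |].
  - by apply: integrableS iy => //; exact: mpre.
  - by apply: integrableS (iB _ _ mg gM); [exact: mD|exact: mpre|move=> z; exact: BX].
have i2c := integrableZl mD 2 icross.
have isum := integrableD mD i2c i2.
have idiff := integrableB mD (iH f mf fM) (iH g mg gM).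
have iall := integrableB mD idiff isum.
have ipD : rho.-integrable D (EFin \o (fun z => `|z.2| `^ (1 + e))) by apply: integrableS ip.
(* (y - a)^2 - (y - b)^2 = 2 (b - a) (y - b) + (a - b)^2 with a = f x, b = g x *)
rewrite [X in `|X|](_ : _ = \int[rho]_(z in D)
  ((huber s (z.2 - f z.1) - huber s (z.2 - g z.1)) -
   (2 * ((g z.1 - f z.1) * (z.2 - g z.1)) + (f z.1 - g z.1) ^+ 2))); last first.
  rewrite RintegralB// RintegralB ?iH// RintegralD//.
  by rewrite RintegralZl// cross0 mulr0 add0r.
apply: (le_trans (le_normr_Rintegral _ _)) => //.
apply: (@le_trans _ _ (\int[rho]_(z in D) (16 * M * 2 `^ e / s `^ e * `|z.2| `^ (1 + e)))).
  apply: le_Rintegral => //.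
  - exact: (integrable_norm iall).
  - by have := integrableZl mD (16 * M * 2 `^ e / s `^ e) ipD; apply: eq_integrable.
  - by move=> z Dz; apply: huber_approx => //; [exact: fM|exact: gM].
rewrite RintegralZl// /Rintegral -(ge0_integral_conull _ _ _ _ D)//.
- by apply: measurable_int ipD.
Qed.

Theorem theorem1 (R : realType) (d : nat)
  (X : set 'rV[R]_d) (Y : set R)
  (rho : probability (Rd R d * R)%type R)
  (fstar : 'rV[R]_d -> R)
  (H : set ('rV[R]_d -> R))
  (eps : R) :
  compact X ->
  (exists A : set (Rd R d * R)%type,
      [/\ measurable A, A `<=` (X : set (Rd R d)) `*` Y & rho A = 1%E]) ->
  cond_exp_version rho X fstar ->
  (exists C : R, forall x, X x -> `|fstar x| <= C) ->
  (forall h, H h -> {within X, continuous h}) ->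
  (exists C : R, forall h, H h -> forall x, X x -> `|h x| <= C) ->
  0 < eps ->
  (\int[rho]_z ((`|z.2| `^ (1 + eps))%:E) < +oo)%E ->
  let M := Num.max (supnorm X fstar) (sup [set supnorm X h | h in H]) in
  exists c : R, 0 < c /\
    forall sigma : R, Num.max (2 * M) 1 < sigma ->
    forall f : 'rV[R]_d -> R,
      measurable_fun (X : set (Rd R d)) (f : Rd R d -> R) ->
      (forall x, X x -> `|f x| <= M) ->
      (`| (huber_risk rho sigma f - huber_risk rho sigma fstar)
           - L2sq rho (fun x => (f x - fstar x)%R) |
         <= ((c / sigma `^ eps)%R)%:E)%E.
Proof.
move=> cX [A [mA AXY A1]] [mfs iy ce] [C fsC] _ _ e0 ipoo M.
have mX := compact_measurable_Rd _ _ _ cX.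
have mpre B : measurable B -> measurable (fst @^-1` B : set (Rd R d * R)).
  by move=> mB; rewrite -[X in measurable X]setTI; exact: measurable_fst.
have X1 : rho (~` (fst @^-1` (X : set (Rd R d)))) = 0%E.
  rewrite probability_setC; last exact: mpre.
  have -> : rho (fst @^-1` (X : set (Rd R d))) = 1%E; last by rewrite subee.
  apply/eqP; rewrite eq_le probability_le1; last exact: mpre.
  rewrite -A1 le_measure ?inE//; first exact: mpre.
  by move=> z /AXY [].
have fsM x : X x -> `|fstar x| <= M.
  move=> Xx; rewrite /M le_max; apply/orP; left.
  apply: ub_le_sup; last by exists x.
  by exists C => _ [y Xy <-]; exact: fsC.
(* A set carrying all the mass is nonempty; a point of [X] yields [0 <= M] through
   [|fstar x| <= M]. *)
have [x Xx] : X !=set0.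
  apply/set0P/negP => /eqP X0; move: X1.
  by rewrite X0 preimage_set0 setC0 probability_setT => /eqP; rewrite onee_eq0.
have M0 : 0 <= M := le_trans (normr_ge0 _) (fsM x Xx).
have ip : rho.-integrable setT (fun z => (`|z.2| `^ (1 + eps))%:E).
  apply/integrableP; split; last first.
    by under eq_integral do rewrite gee0_abs ?lee_fin ?powR_ge0//.
  apply/measurable_EFinP.
  apply: (@measurableT_comp _ _ _ _ _ _ (@powR R ^~ (1 + eps)) setT
    (fun z : Rd R d * R => `|z.2|)); first exact: measurable_powR.
  by apply: measurableT_comp => //; exact: measurable_snd.
pose P := \int[rho]_z (`|z.2| `^ (1 + eps)).
have P0 : 0 <= P by apply: Rintegral_ge0 => z _; exact: powR_ge0.
pose c := 16 * M * 2 `^ eps * P.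
have c0 : 0 <= c by rewrite !mulr_ge0// powR_ge0.
exists (c + 1); split; first by lra.
move=> s; rewrite gt_max => /andP[sM s1] f mf fM.
have s0 : 0 < s by lra.
have gE (B : set (Rd R d)) : measurable B -> B `<=` X ->
    \int[rho]_(z in fst @^-1` B) z.2 = \int[rho]_(z in fst @^-1` B) fstar z.1.
  move=> mB BX; rewrite /Rintegral; have := ce B mB BX.
  rewrite (_ : B `*` setT = fst @^-1` B); last first.
    by apply/seteqP; split => [z []//|z].
  by move=> ->.
apply: le_trans (huber_excess_risk_approx _ _ _ rho X f fstar M s eps
  mX X1 M0 s0 sM e0 iy ip mf fM mfs fsM gE) _.
rewrite lee_fin -/P mulrAC -/c ler_wpM2r ?invr_ge0 ?powR_ge0//; lra.
Qed.
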